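(* Consider the time slot optimization problem described in the context: maximize $\sum_{k=1}^K R^{(k)}(\tau^{(k)})$ over $\boldsymbol{\tau}=(\tau^{(1)},\dots,\tau^{(K)})$ with $\tau^{(k)}\ge 0$ for all $k$, subject to $h(\boldsymbol{\tau})=1-\sum_{k=1}^K\tau^{(k)}=0$. Then $\frac{\partial R^{(k)}}{\partial \tau^{(j)}}=0$ for all $j\ne k$ and $\frac{\partial^2 R^{(k)}}{\partial (\tau^{(k)})^2}<0$, so the problem is convex, and the Karush-Kuhn-Tucker conditions are necessary and sufficient for optimality: $\boldsymbol{\tau}^\ast$ (with $\tau^{(k)\ast}\ge 0$ for all $k$) is an optimal solution if and only if $h(\boldsymbol{\tau}^\ast)=0$ and there exists $\nu^\ast\in\mathbb{R}$ such that $$\left.\frac{\partial R^{(k)}}{\partial\tau^{(k)}}\right|_{\tau^{(k)}=\tau^{(k)\ast}}=\nu^\ast\qquad\text{for all }k\in\{1,\dots,K\},$$ i.e., the derivatives of the individual rates are the same for each user.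
   Context: Data: integers $K,M_r\ge 1$; vectors $\mathbf{h}_r^{(k)}\in\mathbb{C}^{M_r}$ (channel from user $k$ to the relay), non-zero scalars $h_d^{(k)}\in\mathbb{C}$ (direct link from user $k$ to the receiver), and average transmit powers $P^{(k)}$, for $k=1,\dots,K$; a vector $\mathbf{h}\in\mathbb{C}^{M_r}$ (whose Hermitian transpose is the relay-to-receiver channel); relay power $P_r$. $\|\cdot\|$ is the Euclidean norm (absolute value for scalars). In the TDMA-based scheme, user $k$ transmits alone in a slot of duration $\tau^{(k)}\ge 0$, with transmit power $P^{(k)}/\tau^{(k)}$, and its rate is $$R^{(k)}(\tau^{(k)})=\tau^{(k)}\log_2\left(1+\frac{\|h_d^{(k)}\|^2P^{(k)}}{\tau^{(k)}}+\frac{\|\mathbf{h}\|^2P^{(k)}\|\mathbf{h}_r^{(k)}\|^2P_r}{\|\mathbf{h}\|^2P_r\tau^{(k)}+P^{(k)}\|\mathbf{h}_r^{(k)}\|^2+\tau^{(k)}}\right),$$ with the value and the derivative at $\tau^{(k)}=0$ understood as limits for $\tau^{(k)}\to 0^+$ (the rate tends to $0$ and its derivative tends to $+\infty$). *)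

(* Defs.v *)
From HB Require Import structures.
From mathcomp Require Import all_boot all_order all_algebra.
From mathcomp Require Import complex.
From mathcomp Require Import all_classical all_reals all_analysis.

Set Implicit Arguments.
Unset Strict Implicit.
Unset Printing Implicit Defensive.

Import Order.TTheory GRing.Theory Num.Theory.
Import numFieldNormedType.Exports.

Local Open Scope ring_scope.
Local Open Scope classical_set_scope.
Local Open Scope complex_scope.
Local Open Scope convex_scope.

(* Modulus of a complex number, as a real ([`|z|] would be in [R[i]]). *)
Definition cabs (R : realType) (z : R[i]) : R := Normc.normc z.

(* The library norm on matrices is the sup norm, hence this definition. *)
Definition enorm (R : realType) (M : nat) (v : 'cV[R[i]]_M) : R :=
  Num.sqrt (\sum_(i < M) cabs (v i 0) ^+ 2).

Definition log2 (R : realType) (x : R) : R := ln x / ln 2.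

Definition rate_formula (R : realType) (Mr : nat) (hr : 'cV[R[i]]_Mr)
    (hd : R[i]) (h : 'cV[R[i]]_Mr) (P Pr : R) (t : R) : R :=
  t * log2 (1 + cabs hd ^+ 2 * P / t
              + (enorm h ^+ 2 * P * enorm hr ^+ 2 * Pr)
                / (enorm h ^+ 2 * Pr * t + P * enorm hr ^+ 2 + t)).

Definition rate (R : realType) (Mr : nat) (hr : 'cV[R[i]]_Mr)
    (hd : R[i]) (h : 'cV[R[i]]_Mr) (P Pr : R) (t : R) : R :=
  if t == 0 then lim (rate_formula hr hd h P Pr s @[s --> 0^'+])
  else rate_formula hr hd h P Pr t.

(* Derivative on [0, +oo[, as an extended real because the limit that defines
   it at 0 may be infinite (for the rates above it is +oo). *)
Definition ederive (R : realType) (r : R -> R) (t : R) : \bar R :=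
  if t == 0 then lim ((derive1 r s)%:E @[s --> 0^'+])
  else (derive1 r t)%:E.

Definition sum_rate (R : realType) (K : nat) (r : 'I_K -> R -> R)
    (tau : 'rV[R]_K) : R :=
  \sum_(k < K) r k (tau 0 k).

Definition time_constraint (R : realType) (K : nat) (tau : 'rV[R]_K) : R :=
  1 - \sum_(k < K) tau 0 k.

Definition orthant (R : realType) (K : nat) : set 'rV[R]_K :=
  [set tau | forall k, 0 <= tau 0 k].

(* The problem: maximize [f x] over [x] in [D] subject to [g x = 0]. *)
Definition optimal_solution (R : realType) (E : lmodType R)
    (D : set E) (f g : E -> R) (x : E) : Prop :=
  [/\ D x, g x = 0 & forall y, D y -> g y = 0 -> f y <= f x].

Definition convex_problem (R : realType) (E : lmodType R)
    (D : set E) (f g : E -> R) : Prop :=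
  [/\ @convex_set R E D,
      @convex_function R E D (fun x => - f x)
    & forall (p : {i01 R}) (x y : convex_lmodType E),
        g (x <| p |> y) = (g x : R^o) <| p |> (g y : R^o)].

(* Main.v *)
(** Each rate has, up to the factor [1 / ln 2], the form [t ln g] with
[g = 1 + a / t + e b / (d t + b)], so its second derivative is
[(2 g' + t g'') / g - t (g' / g)^2]; the contributions of [a / t] to
[2 g' + t g''] cancel and what remains is nonpositive, whence strict concavity.
Since [- g <= t g'], the first derivative is at least [ln g - 1] and blows up at
[0].  Concavity enters the optimality conditions only through tangent lines: if
all derivatives equal [nu], adding the tangent inequalities over the users bounds
every feasible sum rate; conversely, moving a little time from user [j] to user
[k] compares the two derivatives, and the blow-up at [0] shows that every user
has a nonempty slot. *)
Require Import Defs.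
From HB Require Import structures.
From mathcomp Require Import all_boot all_order all_algebra.
From mathcomp Require Import complex.
From mathcomp Require Import all_classical all_reals all_analysis.
From mathcomp Require Import ring lra.

Import Order.TTheory GRing.Theory Num.Theory.
Import numFieldNormedType.Exports.

Local Open Scope ring_scope.
Local Open Scope classical_set_scope.
Local Open Scope complex_scope.

Set Implicit Arguments.
Unset Strict Implicit.

(** * Strictly concave rates on the half-line with infinite slope at 0 *)

Record concave_rate (R : realType) (f df ddf : R -> R) : Prop := ConcaveRate {
  rate_derive : forall t : R, 0 < t -> is_derive t 1 f (df t);
  rate_derive2 : forall t : R, 0 < t -> is_derive t 1 df (ddf t);
  rate_derive2_lt0 : forall t : R, 0 < t -> ddf t < 0;
  rate_cvg0 : f x @[x --> 0^'+] --> f 0;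
  rate_derive_cvg0 : df x @[x --> 0^'+] --> +oo }.

Lemma rate_derive_decr (R : realType) (f df ddf : R -> R) (s t : R) :
  concave_rate f df ddf -> 0 < s -> s <= t -> df t <= df s.
Proof.
move=> fP s0; rewrite le_eqVlt => /predU1P[-> //|st].
have pos x : x \in `[s, t]%R -> 0 < x.
  by rewrite in_itv/= => /andP[sx _]; exact: lt_le_trans sx.
have sub x : x \in `]s, t[%R -> x \in `[s, t]%R.
  by rewrite !in_itv/= => /andP[? ?]; rewrite !ltW.
have [x||c cst E] := @MVT R df ddf s t st.
- by move=> /sub/pos/(rate_derive2 fP).
- apply: continuous_in_subspaceT => x /[!inE] /pos x0.
  by apply/differentiable_continuous/derivable1_diffP; case: (rate_derive2 fP x0).
rewrite -subr_le0 E mulr_le0_ge0 ?subr_ge0 1?ltW//.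
by apply: (rate_derive2_lt0 fP); exact/pos/sub.
Qed.

Lemma rate_continuous (R : realType) (f df ddf : R -> R) (t : R) :
  concave_rate f df ddf -> 0 < t -> {for t, continuous f}.
Proof.
move=> fP t0; apply/differentiable_continuous/derivable1_diffP.
by case: (rate_derive fP t0).
Qed.

(** The left endpoint may be 0, where [f] has no finite slope: the mean value theorem asks only for
    continuity there, and [rate_cvg0] supplies it. *)
Lemma rate_MVT (R : realType) (f df ddf : R -> R) (s t : R) :
  concave_rate f df ddf -> 0 <= s -> s < t ->
  exists c, [/\ s < c, c < t & f t - f s = df c * (t - s)].
Proof.
move=> fP s0 st.
have pos x : s < x -> 0 < x by exact: le_lt_trans.
have [x /[!in_itv]/= /andP[/pos x0 _]||c] := @MVT R f df s t st.
- by have := rate_derive fP x0.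
- apply/continuous_within_itvP => //; split.
  + move=> x /[!in_itv]/= /andP[/pos x0 _]; exact: rate_continuous fP x0.
  + move: s0; rewrite le_eqVlt => /predU1P[<-|s0]; first exact: rate_cvg0 fP.
    apply: cvg_at_right_filter; exact: rate_continuous fP s0.
  + apply: cvg_at_left_filter; apply: rate_continuous fP _; exact: pos.
by rewrite in_itv/= => /andP[? ?] ?; exists c.
Qed.

Lemma rate_tangent (R : realType) (f df ddf : R -> R) (s t : R) :
  concave_rate f df ddf -> 0 <= s -> 0 < t -> f s <= f t + df t * (s - t).
Proof.
move=> fP s0 t0; case: (ltgtP s t) => [st|ts|->]; last by rewrite subrr mulr0 addr0.
- have [c [sc ct E]] := rate_MVT fP s0 st.
  have := rate_derive_decr fP (le_lt_trans s0 sc) (ltW ct).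
  by rewrite -(ler_pM2r (_ : 0 < t - s)) ?subr_gt0//; lra.
- have [c [tc cs E]] := rate_MVT fP (ltW t0) ts.
  have := rate_derive_decr fP t0 (ltW tc).
  by rewrite -(ler_pM2r (_ : 0 < s - t)) ?subr_gt0//; lra.
Qed.

(** The tangent at the barycentre bounds [f s] and [f t]; with weights [p] and [1 - p] the linear
    terms cancel. *)
Lemma rate_concave (R : realType) (f df ddf : R -> R) (p s t : R) :
  concave_rate f df ddf -> 0 <= p -> p <= 1 -> 0 <= s -> 0 <= t ->
  p * f s + (1 - p) * f t <= f (p * s + (1 - p) * t).
Proof.
move=> fP p0 p1 s0 t0.
have q0 : 0 <= 1 - p by rewrite subr_ge0.
(* At a barycentre equal to 0 there is no tangent. Both products then vanish, and each choice of
   vanishing factors is settled directly. *)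
have [/eqP|] := eqVneq (p * s + (1 - p) * t) 0.
  rewrite paddr_eq0 ?mulr_ge0// !mulf_eq0.
  move=> /andP[/orP[]/eqP E1 /orP[]/eqP E2].
  - by lra.
  - by rewrite E1 E2 !(mul0r, mulr0, subr0, add0r, mul1r).
  - have -> : p = 1 by lra.
    by rewrite E1 subrr !(mul0r, mulr0, subr0, addr0, mul1r).
  - by rewrite E1 E2 !(mulr0, addr0) -mulrDl addrC subrK mul1r.
set x := (X in X != 0) => x0.
have {}x0 : 0 < x by rewrite lt_neqAle eq_sym x0 addr_ge0// mulr_ge0.
have := ler_wpM2l p0 (rate_tangent fP s0 x0).
have := ler_wpM2l q0 (rate_tangent fP t0 x0).
set D := df x; rewrite -/x.
move=> Ht Hs; have E : f x = p * (f x + D * (s - x)) + (1 - p) * (f x + D * (t - x)).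
  by rewrite /x; ring.
by rewrite E lerD.
Qed.

Lemma rate_derive1 (R : realType) (f df ddf : R -> R) (t : R) :
  concave_rate f df ddf -> 0 < t -> derive1 f t = df t.
Proof.
by move=> fP t0; have D := rate_derive fP t0; rewrite derive1E; exact: derive_val.
Qed.

Lemma rate_is_derive1 (R : realType) (f df ddf : R -> R) (t : R) :
  concave_rate f df ddf -> 0 < t -> is_derive t 1 (derive1 f) (ddf t).
Proof.
move=> fP t0; apply: near_eq_is_derive (rate_derive2 fP t0).
near=> x; apply/esym/(rate_derive1 fP).
by near: x; exact: lt_nbhsr.
Unshelve. all: by end_near. Qed.

Lemma ederive_rate0 (R : realType) (f df ddf : R -> R) :
  concave_rate f df ddf -> ederive f 0 = +oo%E.
Proof.
move=> fP; rewrite /ederive eqxx; apply: cvg_lim => //.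
apply/cvgeryP; apply: cvg_trans (rate_derive_cvg0 fP); apply: near_eq_cvg.
near=> x; apply/esym/(rate_derive1 fP).
by near: x; exact: nbhs_right_gt.
Unshelve. all: by end_near. Qed.

Lemma ederive_rate (R : realType) (f df ddf : R -> R) (t : R) :
  concave_rate f df ddf -> 0 < t -> ederive f t = (df t)%:E.
Proof. by move=> fP t0; rewrite /ederive gt_eqF// (rate_derive1 fP). Qed.

Lemma sumr_indicator (V : nmodType) (K : nat) (k : 'I_K) (c : 'I_K -> V) :
  \sum_i (if i == k then c i else 0) = c k.
Proof. by rewrite -big_mkcond big_pred1_eq. Qed.

(** * Optimality conditions for a sum of concave rates *)

Section kkt.
Variables (R : realType) (K : nat) (f df ddf : 'I_K -> R -> R).
Hypothesis fP : forall k, concave_rate (f k) (df k) (ddf k).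

Local Notation optimal :=
  (optimal_solution (@orthant R K) (sum_rate f) (@time_constraint R K)).

(* Move [e] units of time from user [j] to user [k] and compare the two
   allocations through the tangents at the new one. *)
Lemma optimal_exchange (tau : 'rV[R]_K) (j k : 'I_K) (e : R) :
  optimal tau -> j != k -> 0 < e -> e < tau 0 j ->
  df k (tau 0 k + e) <= df j (tau 0 j - e).
Proof.
case=> tau0 sum1 opt jk e0 ej.
pose y : 'rV[R]_K := \row_i (tau 0 i
  + ((if i == k then e else 0) - (if i == j then e else 0))).
have kj : (k == j) = false by rewrite eq_sym (negbTE jk).
have yk : y 0 k = tau 0 k + e by rewrite mxE eqxx kj subr0.
have yj : y 0 j = tau 0 j - e by rewrite mxE eqxx (negbTE jk) sub0r.
have y0 : orthant y.
  move=> i; have [->|ik] := eqVneq i k; first by rewrite yk addr_ge0 ?tau0// ltW.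
  have [->|ij] := eqVneq i j; first by rewrite yj subr_ge0 ltW.
  by rewrite mxE (negbTE ik) (negbTE ij) subr0 addr0; exact: tau0.
have ysum : time_constraint y = 0.
  rewrite -sum1 /time_constraint; congr (_ - _).
  under eq_bigr do rewrite mxE.
  by rewrite big_split sumrB/= !sumr_indicator subrr addr0.
(* Tangents are taken at [y], not at [tau]: the slot of [k] may be empty in [tau], whereas both
   changed slots are positive in [y]. *)
have tangent i : f i (tau 0 i) <= f i (y 0 i)
    + ((if i == j then df i (y 0 i) * e else 0)
       - (if i == k then df i (y 0 i) * e else 0)).
  have [->|ik] := eqVneq i k.
    rewrite kj sub0r yk.
    have := rate_tangent (fP k) (tau0 k) (_ : 0 < tau 0 k + e).
    have -> : tau 0 k - (tau 0 k + e) = - e by ring.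
    by rewrite mulrN; apply; rewrite ltr_wpDl ?tau0.
  have [->|ij] := eqVneq i j.
    rewrite subr0 yj.
    have := rate_tangent (fP j) (tau0 j) (_ : 0 < tau 0 j - e).
    have -> : tau 0 j - (tau 0 j - e) = e by ring.
    by apply; rewrite subr_gt0.
  by rewrite mxE (negbTE ik) (negbTE ij) subr0 !addr0.
(* Optimality cancels the two sum rates, so the total tangent correction, [e] times the difference
   of the two slopes, is nonnegative. *)
have := opt y y0 ysum; rewrite /sum_rate => le_yt.
have := le_trans le_yt (ler_sum _ (fun i _ => tangent i)).
rewrite big_split sumrB/= !sumr_indicator yk yj lerDl subr_ge0.
by rewrite ler_pM2r.
Qed.

(** Were the slot of [k] empty, giving it a small [e] would yield a slope exceeding any bound. As
    long as [e < tau 0 j / 2], user [j] keeps more than half of its slot, so its slope stays at most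
    [df j (tau 0 j / 2)], against [optimal_exchange]. *)
Lemma optimal_gt0 (tau : 'rV[R]_K) (j k : 'I_K) :
  optimal tau -> 0 < tau 0 j -> 0 < tau 0 k.
Proof.
move=> opt tj0; have tau0 : orthant tau by case: opt.
rewrite lt_neqAle tau0 andbT; apply/eqP => tk0.
have jk : j != k by apply: contraTneq tj0 => ->; rewrite -tk0 ltxx.
have tj2 : 0 < tau 0 j / 2 by rewrite divr_gt0.
have/cvgryPgt/(_ (df j (tau 0 j / 2))) := rate_derive_cvg0 (fP k).
move=> large; have ex : \forall e \near 0^'+,
    [/\ df j (tau 0 j / 2) < df k e, 0 < e & e < tau 0 j / 2].
  near=> e; split; near: e => //; [exact: nbhs_right_gt|exact: nbhs_right_lt].
have [e [fke e0 etj]] := @filter_ex _ _ (at_right_proper_filter 0) _ ex.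
move: fke; apply/negP; rewrite -leNgt.
have := optimal_exchange opt jk e0 (_ : e < tau 0 j).
rewrite -tk0 add0r => /(_ _)/le_trans; apply; first by lra.
by apply: (rate_derive_decr (fP j)); lra.
Unshelve. all: by end_near. Qed.

(** This is the limit of [optimal_exchange] as [e] tends to 0 from the right, by continuity of the
    derivatives at positive times. *)
Lemma optimal_derive_le (tau : 'rV[R]_K) (j k : 'I_K) :
  optimal tau -> 0 < tau 0 j -> 0 < tau 0 k -> df k (tau 0 k) <= df j (tau 0 j).
Proof.
move=> opt tj0 tk0.
have [->//|jk] := eqVneq j k.
have dfc i x : 0 < x -> {for x, continuous (df i)}.
  move=> x0; apply/differentiable_continuous/derivable1_diffP.
  by case: (rate_derive2 (fP i) x0).
have cvg_shift i (s : R) : 0 < tau 0 i ->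
    df i (tau 0 i + s * e) @[e --> 0^'+] --> df i (tau 0 i).
  move=> ti0; apply: cvg_at_right_filter.
  have E : tau 0 i = tau 0 i + s * 0 by rewrite mulr0 addr0.
  rewrite {2}E; apply: (@continuous_comp _ _ _ (fun e => tau 0 i + s * e) (df i)).
    by apply: cvgD; [exact: cvg_cst|apply: cvgMr; exact: cvg_id].
  by apply: dfc; rewrite -E.
apply: ler_cvg_to (cvg_shift k 1 tk0) (cvg_shift j (- 1) tj0) _.
near=> e; rewrite mul1r mulN1r.
have e0 : 0 < e by near: e; exact: nbhs_right_gt.
have ej : e < tau 0 j by near: e; exact: nbhs_right_lt.
exact: optimal_exchange.
Unshelve. all: by end_near. Qed.

Theorem optimal_solution_kkt (tau : 'rV[R]_K) : orthant tau ->
  (optimal tau <->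
   time_constraint tau = 0 /\
   exists nu : R, forall k : 'I_K, ederive (f k) (tau 0 k) = nu%:E).
Proof.
move=> tau0; split=> [opt|[sum1 [nu nuP]]].
- have sum1 : time_constraint tau = 0 by case: opt.
  split=> //.
  (* The slots add up to 1, so they cannot all be empty; the slope of a nonempty one serves as the
     multiplier. *)
  have [j tj0] : exists j, 0 < tau 0 j.
    apply/existsP; apply: contraT => /existsPn nonpos.
    move/eqP: sum1; rewrite /time_constraint subr_eq0.
    rewrite big1 ?oner_eq0// => i _; apply/le_anti.
    by rewrite tau0 andbT leNgt nonpos.
  exists (df j (tau 0 j)) => k.
  have tk0 := optimal_gt0 k opt tj0.
  rewrite (ederive_rate (fP k) tk0); congr (_%:E); apply/le_anti.
  by rewrite !optimal_derive_le.
(* The multiplier is a real number, while the extended derivative at 0 is [+oo]; hence no slot is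
   empty. *)
- have t0 k : 0 < tau 0 k.
    rewrite lt_neqAle tau0 andbT; apply/eqP => tk0.
    by have := nuP k; rewrite -tk0 (ederive_rate0 (fP k)).
  split=> // y y0 ysum.
  (* With a common slope the corrections add up to [nu] times the difference of the total times,
     which is 0. *)
  have tangent k : f k (y 0 k) <= f k (tau 0 k) + nu * (y 0 k - tau 0 k).
    have := nuP k; rewrite (ederive_rate (fP k) (t0 k)) => -[<-].
    exact: rate_tangent (fP k) (y0 k) (t0 k).
  apply: (le_trans (ler_sum _ (fun k _ => tangent k))).
  rewrite big_split/= -mulr_sumr sumrB.
  have -> : \sum_k y 0 k = \sum_k tau 0 k.
    by move: sum1 ysum; rewrite /time_constraint; lra.
  by rewrite subrr mulr0 addr0.
Qed.

Lemma convex_sum_rate :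
  convex_problem (@orthant R K) (sum_rate f) (@time_constraint R K).
Proof.
have p01 (p : {i01 R}) : 0 <= p%:num /\ p%:num <= 1 by split.
split.
- move=> x y p /[!inE] x0 y0 k; have [p0 p1] := p01 p.
  by rewrite !mxE addr_ge0// mulr_ge0// ?subr_ge0.
- move=> p x y /[!inE] x0 y0; have [p0 p1] := p01 p.
  rewrite convRE /sum_rate !mulrN -opprD lerN2 !mulr_sumr -big_split/=.
  apply: ler_sum => k _; rewrite !mxE.
  exact: rate_concave (fP k) p0 p1 (x0 k) (y0 k).
- move=> p x y; rewrite convRE /time_constraint.
  under eq_bigr do rewrite !mxE.
  rewrite big_split/= -!mulr_sumr /unstable.onem; ring.
Qed.

End kkt.

(* One plus the signal-to-noise ratio of a user, as a function of its slot length;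
   the paper's data enter as [a = |hd|^2 P], [b = P |hr|^2], [e = |h|^2 Pr] and
   [d = e + 1]. *)
Definition snr1 (R : realType) (a b d e t : R) : R :=
  1 + a / t + e * b / (d * t + b).

Definition dsnr1 (R : realType) (a b d e t : R) : R :=
  - (a / t ^+ 2) - e * b * d / (d * t + b) ^+ 2.

Definition ddsnr1 (R : realType) (a b d e t : R) : R :=
  2 * a / t ^+ 3 + 2 * e * b * d ^+ 2 / (d * t + b) ^+ 3.

Definition af_rate (R : realType) (a b d e t : R) : R :=
  t * log2 (snr1 a b d e t).

Definition daf_rate (R : realType) (a b d e t : R) : R :=
  (ln (snr1 a b d e t) + t * dsnr1 a b d e t / snr1 a b d e t) / ln 2.

Definition ddaf_rate (R : realType) (a b d e t : R) : R :=
  ((2 * dsnr1 a b d e t + t * ddsnr1 a b d e t) / snr1 a b d e t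
   - t * (dsnr1 a b d e t / snr1 a b d e t) ^+ 2) / ln 2.

(** * Derivatives, strict concavity and behaviour at 0 of the explicit rate *)

Section amplify_forward.
Variables (R : realType) (a b d e : R).
Hypotheses (a0 : 0 < a) (b0 : 0 <= b) (d0 : 0 < d) (e0 : 0 <= e).
Local Notation g := (snr1 a b d e).
Local Notation dg := (dsnr1 a b d e).
Local Notation ddg := (ddsnr1 a b d e).

Local Notation f := (af_rate a b d e).
Local Notation df := (daf_rate a b d e).
Local Notation ddf := (ddaf_rate a b d e).

Let den_gt0 (t : R) : 0 < t -> 0 < d * t + b.
Proof. by move=> t0; rewrite ltr_wpDr// mulr_gt0. Qed.

(** The relay can only help, so the direct link alone bounds the ratio from below; this gives
    positivity of [g] and its blow-up at 0. *)
Lemma snr1_ge (t : R) : 0 < t -> 1 + a / t <= g t.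
Proof. by move=> t0; rewrite lerDl divr_ge0 ?mulr_ge0// ltW// den_gt0. Qed.

Lemma snr1_gt0 (t : R) : 0 < t -> 0 < g t.
Proof.
by move=> t0; rewrite (lt_le_trans _ (snr1_ge t0))// addr_gt0// divr_gt0.
Qed.

Lemma is_derive_snr1 (t : R) : 0 < t -> is_derive t 1 g (dg t).
Proof.
move=> t0; have h0 := den_gt0 t0.
have t0' : (id : R -> R) t != 0 by rewrite gt_eqF.
have h0' : (fun x : R => d * x + b) t != 0 by rewrite gt_eqF.
have D1 := @is_deriveV R id t 1 1 t0' (is_derive_id t 1).
have D3 : is_derive t 1 (fun x : R => d * x + b) d.
  by apply: is_derive_eq; rewrite /= addr0 /GRing.scale/= mulr1.
have D2 := @is_deriveV R (fun x : R => d * x + b) t _ 1 h0' D3.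
apply: is_derive_eq.
rewrite /GRing.scale/= /dsnr1; field.
by rewrite !gt_eqF.
Qed.

Lemma is_derive_dsnr1 (t : R) : 0 < t -> is_derive t 1 dg (ddg t).
Proof.
move=> t0; have h0 := den_gt0 t0.
have t0' : (fun x : R => x ^+ 2) t != 0 by rewrite expf_neq0// gt_eqF.
have h0' : (fun x : R => (d * x + b) ^+ 2) t != 0 by rewrite expf_neq0// gt_eqF.
have D0 : is_derive t 1 (fun x : R => x ^+ 2) (2 * t).
  by apply: is_derive_eq; rewrite /GRing.scale/=; ring.
have D1 := @is_deriveV R (fun x : R => x ^+ 2) t _ 1 t0' D0.
have D3 : is_derive t 1 (fun x : R => (d * x + b) ^+ 2) (2 * d * (d * t + b)).
  by apply: is_derive_eq; rewrite /GRing.scale/=; ring.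
have D2 := @is_deriveV R (fun x : R => (d * x + b) ^+ 2) t _ 1 h0' D3.
apply: is_derive_eq.
rewrite /GRing.scale/= /ddsnr1; field.
by rewrite !gt_eqF.
Qed.

Lemma is_derive_ln_snr1 (t : R) :
  0 < t -> is_derive t 1 (fun x => ln (g x)) (dg t / g t).
Proof.
move=> t0; rewrite mulrC; apply: (@is_derive1_comp R (@ln R) g); last exact: is_derive_snr1.
exact/is_derive1_ln/snr1_gt0.
Qed.

Let ln2_gt0 : 0 < ln 2 :> R.
Proof. by rewrite ln_gt0// ltr1n. Qed.

Lemma is_derive_af_rate (t : R) : 0 < t -> is_derive t 1 f (df t).
Proof.
move=> t0; have D := is_derive_ln_snr1 t0.
have -> : f = (fun x => x * ln (g x) * (ln 2)^-1).
  by apply/funext => x; rewrite /af_rate /log2 mulrA.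
apply: is_derive_eq.
by rewrite /GRing.scale/= /daf_rate; ring.
Qed.

Lemma is_derive2_af_rate (t : R) : 0 < t -> is_derive t 1 df (ddf t).
Proof.
move=> t0; have D := is_derive_ln_snr1 t0.
have g0 := snr1_gt0 t0.
have g0' : g t != 0 by rewrite gt_eqF.
have D1 := @is_deriveV R g t _ 1 g0' (is_derive_snr1 t0).
have D2 := is_derive_dsnr1 t0.
have -> : df = (fun x => (ln (g x) + x * dg x * (g x)^-1) * (ln 2)^-1) by [].
apply: is_derive_eq.
rewrite /GRing.scale/= /ddaf_rate; field.
by rewrite g0' gt_eqF.
Qed.

Lemma af_rate2_lt0 (t : R) : 0 < t -> ddf t < 0.
Proof.
move=> t0; have h0 := den_gt0 t0; have g0 := snr1_gt0 t0.
have E : 2 * dg t + t * ddg t = - (2 * e * b * d * b / (d * t + b) ^+ 3).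
  by rewrite /dsnr1 /ddsnr1; field; rewrite !gt_eqF.
rewrite /ddaf_rate E pmulr_llt0 ?invr_gt0// mulNr -opprD oppr_lt0.
rewrite ltr_wpDl//.
  by rewrite divr_ge0 ?divr_ge0 ?exprn_ge0 ?mulr_ge0 // ltW.
(* The relay contribution may vanish, for instance when [b = 0]. Strictness comes from the square,
   since [a > 0] forces [dg t] to be nonzero. *)
have dg0 : dg t < 0.
  rewrite /dsnr1 ltr_wnDr ?oppr_lt0 ?oppr_le0 ?divr_gt0 ?exprn_gt0//.
  by rewrite divr_ge0 ?exprn_ge0 ?mulr_ge0// ltW.
by rewrite mulr_gt0// exprn_even_gt0//= mulf_neq0 ?invr_neq0 ?(gt_eqF g0) ?(lt_eqF dg0).
Qed.

Lemma af_rate_cvg0 : f x @[x --> 0^'+] --> 0.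
Proof.
(* For [x < 1] the three terms of [g x] are at most [1 / x], [a / x] and [e / x], hence
   [g x <= M / x]. *)
pose M := 1 + a + e.
have M0 : 0 < M by rewrite ltr_wpDr// addr_gt0.
apply: (@squeeze_cvgr _ _ _ _ (fun=> 0) (fun x => 2 * Num.sqrt (M * x) / ln 2)).
- near=> x.
  have x0 : 0 < x by near: x; exact: nbhs_right_gt.
  have x1 : x < 1 by near: x; exact: nbhs_right_lt.
  have g1 : 1 <= g x.
    by rewrite (le_trans _ (snr1_ge x0))// lerDl divr_ge0// ltW.
  have gM : g x <= M / x.
    rewrite /snr1 /M !mulrDl !lerD//.
      by rewrite mul1r invf_ge1 ?ltW.
    rewrite ler_pdivrMr ?den_gt0// -mulrA ler_wpM2l// mulrDr.
    rewrite ler_wpDl ?mulr_ge0 ?invr_ge0// ?(ltW d0) ?(ltW x0)//.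
    by rewrite ler_peMl// invf_ge1 ?(ltW x1).
  have Mx0 : 0 < M / x by rewrite divr_gt0.
  (* Applying [ln u <= u] to [M / x] would only bound [x * ln (M / x)] by [M]. Applied to the square
     root it gives [2 * x * y], which tends to 0. *)
  set y := Num.sqrt (M / x).
  have y0 : 0 < y by rewrite sqrtr_gt0.
  have lny : ln y <= y.
    have E : 1 + (y - 1) = y by ring.
    by have := @le_ln1Dx R (y - 1); rewrite E => H; apply: (le_trans (H _)); lra.
  have lng : ln (g x) <= 2 * y.
    rewrite (le_trans (_ : _ <= ln (M / x)))//.
      by rewrite ler_ln ?posrE// snr1_gt0.
    have -> : M / x = y ^+ 2 by rewrite sqr_sqrtr// ltW.
    by rewrite lnXn// mulr2n; lra.
  have xy : x * y = Num.sqrt (M * x).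
    rewrite -{1}(ger0_norm (ltW x0)) -sqrtr_sqr -sqrtrM ?sqr_ge0//.
    by congr Num.sqrt; field; rewrite gt_eqF.
  apply/andP; split.
    by rewrite /af_rate /log2 mulr_ge0 ?(ltW x0)// divr_ge0 ?ln_ge0 ?(ltW ln2_gt0) ?ler1n.
  rewrite /af_rate /log2 mulrA ler_pM2r ?invr_gt0//.
  by rewrite -xy mulrCA ler_pM2l.
- exact: cvg_cst.
- suff : 2 * Num.sqrt (M * x) / ln 2 @[x --> 0^'+] --> 2 * Num.sqrt (M * 0) / ln 2.
    by rewrite mulr0 sqrtr0 mulr0 mul0r.
  apply: cvgMl; apply: cvgMr; apply: cvg_at_right_filter.
  apply: (cvg_comp (fun x => M * x) (@Num.sqrt R)); last exact: sqrt_continuous.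
  exact: mulrl_continuous.
Unshelve. all: by end_near. Qed.

Lemma af_rate_derive_cvg0 : df x @[x --> 0^'+] --> +oo.
Proof.
apply/cvgryPge => A.
(* Below this threshold [a / x], hence [g x], exceeds [expR (A * ln 2 + 1)]. The extra 1 absorbs the
   other summand of the derivative, which is at least [- 1]. *)
have aE : 0 < a / expR (A * ln 2 + 1) by rewrite divr_gt0 ?expR_gt0.
near=> x.
have x0 : 0 < x by near: x; exact: nbhs_right_gt.
have h0 := den_gt0 x0; have g0 := snr1_gt0 x0.
have xE : x < a / expR (A * ln 2 + 1).
  by near: x; exact: nbhs_right_lt aE.
rewrite /daf_rate ler_pdivlMr//.
have lng : A * ln 2 + 1 <= ln (g x).
  rewrite -(expRK (A * ln 2 + 1)) ler_ln ?posrE ?expR_gt0//.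
  have aEx : expR (A * ln 2 + 1) < a / x.
    by rewrite ltr_pdivlMr// mulrC -ltr_pdivlMr ?expR_gt0.
  by rewrite (le_trans (ltW aEx))// (le_trans _ (snr1_ge x0))// lerDr.
have : - 1 <= x * dg x / g x.
  rewrite ler_pdivlMr// mulN1r -subr_ge0.
  have -> : x * dg x - - g x = 1 + e * b * b / (d * x + b) ^+ 2.
    by rewrite /dsnr1 /snr1; field; rewrite !gt_eqF.
  by rewrite addr_ge0// divr_ge0 ?exprn_ge0 ?mulr_ge0// ltW.
lra.
Unshelve. all: by end_near. Qed.
End amplify_forward.

(** * From the channel data to the theorem *)

Lemma rate_formulaE (R : realType) (Mr : nat) (hr : 'cV[R[i]]_Mr) (hd : R[i])
    (h : 'cV[R[i]]_Mr) (P Pr t : R) :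
  rate_formula hr hd h P Pr t =
  af_rate (cabs hd ^+ 2 * P) (P * enorm hr ^+ 2) (enorm h ^+ 2 * Pr + 1)
    (enorm h ^+ 2 * Pr) t.
Proof.
rewrite /rate_formula /af_rate /snr1; congr (_ * log2 (_ + _ / _)); ring.
Qed.

Lemma rate_is_concave_rate (R : realType) (Mr : nat) (hr : 'cV[R[i]]_Mr)
    (hd : R[i]) (h : 'cV[R[i]]_Mr) (P Pr : R) :
    hd != 0 -> 0 < P -> 0 <= Pr ->
  exists df ddf, concave_rate (rate hr hd h P Pr) df ddf.
Proof.
move=> hd0 P0 Pr0.
pose a := cabs hd ^+ 2 * P; pose b := P * enorm hr ^+ 2.
pose e := enorm h ^+ 2 * Pr; pose d := e + 1.
(* The nonzero direct link enters here; positivity of [a] yields both strict concavity and the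
   infinite slope at 0. *)
have a0 : 0 < a.
  rewrite mulr_gt0// exprn_even_gt0//=; apply: contra_neq hd0.
  exact: Normc.eq0_normc.
have b0 : 0 <= b by rewrite mulr_ge0 ?sqr_ge0// ltW.
have e0 : 0 <= e by rewrite mulr_ge0 ?sqr_ge0.
have d0 : 0 < d by rewrite ltr_wpDl.
have formulaE : rate_formula hr hd h P Pr = af_rate a b d e.
  by apply/funext => t; exact: rate_formulaE.
have rateE t : 0 < t -> rate hr hd h P Pr t = af_rate a b d e t.
  by move=> t0; rewrite /rate gt_eqF// formulaE.
have rate0 : rate hr hd h P Pr 0 = 0.
  rewrite /rate eqxx formulaE.
  by apply: cvg_lim => //; exact: af_rate_cvg0.
exists (daf_rate a b d e), (ddaf_rate a b d e); split.
- move=> t t0; apply: near_eq_is_derive (is_derive_af_rate a0 b0 d0 e0 t0).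
  by near=> x; apply/esym/rateE; near: x; exact: lt_nbhsr.
- by move=> t; exact: is_derive2_af_rate.
- by move=> t; exact: af_rate2_lt0.
- rewrite rate0; apply: cvg_trans (af_rate_cvg0 a0 b0 d0 e0).
  apply: near_eq_cvg; near=> x; apply/esym/rateE.
  by near: x; exact: nbhs_right_gt.
- exact: af_rate_derive_cvg0.
Unshelve. all: by end_near. Qed.

Unset Implicit Arguments.
Set Strict Implicit.

Theorem mainTheorem5 (R : realType) (K Mr : nat)
    (hr : 'I_K -> 'cV[R[i]]_Mr) (hd : 'I_K -> R[i]) (P : 'I_K -> R)
    (h : 'cV[R[i]]_Mr) (Pr : R)
    (K_ge1 : (1 <= K)%N) (Mr_ge1 : (1 <= Mr)%N)
    (hd_neq0 : forall k, hd k != 0)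
    (P_gt0 : forall k, 0 < P k) (Pr_ge0 : 0 <= Pr) :
  let r (k : 'I_K) (t : R) : R := rate (hr k) (hd k) h (P k) Pr t in
  [/\ (forall (k j : 'I_K) (tau : 'rV[R]_K), j != k -> orthant tau ->
         is_derive tau (delta_mx 0 j : 'rV[R]_K)
           (fun s : 'rV[R]_K => r k (s 0 k)) 0),
      (forall (k : 'I_K) (t : R), 0 < t ->
         [/\ derivable (r k) t 1, derivable (derive1 (r k)) t 1
           & derive1n 2 (r k) t < 0]),
      convex_problem (@orthant R K) (sum_rate r) (@time_constraint R K)
    & forall tau : 'rV[R]_K, orthant tau ->
        (optimal_solution (@orthant R K) (sum_rate r) (@time_constraint R K) tau
         <->
         time_constraint tau = 0 /\
         exists nu : R, forall k : 'I_K,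
           ederive (r k) (tau 0 k) = nu%:E)].
Proof.
move=> r.
have /choice[df /choice[ddf rP]] :
    forall k, exists df ddf, concave_rate (r k) df ddf.
  by move=> k; exact: rate_is_concave_rate.
split.
- move=> k j tau jk _.
  (* Moving along coordinate [j] leaves coordinate [k] fixed, so the difference quotient is
     identically 0. No regularity of [r k] is involved, and slots of length 0 are covered too. *)
  have cst_r (e : R) : r k ((e *: delta_mx 0 j + tau : 'rV[R]_K) 0 k) = r k (tau 0 k).
    by rewrite !mxE eqxx eq_sym (negbTE jk) mulr0 add0r.
  have cvg0 : e^-1 *: (((fun s : 'rV[R]_K => r k (s 0 k)) \o shift tau)
      (e *: (delta_mx 0 j : 'rV[R]_K)) - r k (tau 0 k)) @[e --> 0^'] --> (0 : R).
    apply: cvg_near_cst; near=> e.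
    by rewrite /= cst_r subrr scaler0.
  by apply: DeriveDef; [exact: cvgP cvg0|exact: cvg_lim cvg0].
- move=> k t t0.
  have D1 := rate_derive (rP k) t0; have D2 := rate_is_derive1 (rP k) t0.
  split; [by case: D1|by case: D2|].
  have -> : derive1n 2 (r k) t = ddf k t by rewrite /= derive1E; exact: derive_val.
  exact: rate_derive2_lt0 (rP k) _ t0.
- exact: convex_sum_rate rP.
- exact: optimal_solution_kkt rP.
Unshelve. all: by end_near. Qed.
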